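(* Let $\mathrm{k}$ be an infinite field and $\mathcal{A}$ a unital associative $\mathrm{k}$-algebra satisfying $\mathbf{H}_{\mathrm{s}}$. Let $V$ and $W$ be finite-dimensional $\mathrm{k}$-subspaces of $\mathcal{A}$ with $V\cap U(\mathcal{A})\neq\emptyset$ and $W\cap U(\mathcal{A})\neq\emptyset$, such that $\dim_{\mathrm{k}}(W)\geq\dim_{\mathrm{k}}(V)$ and $\dim_{\mathrm{k}}(\mathrm{k}\langle WV\rangle)\leq(2-\varepsilon)\dim_{\mathrm{k}}(V)$ for some real $0<\varepsilon<2$. Then there exists a finite-dimensional subalgebra $\mathcal{H}$ of $\mathcal{A}$ such that $\dim_{\mathrm{k}}(\mathcal{H})\leq(\frac{2}{\varepsilon}-1)\dim_{\mathrm{k}}(V)$, and $V$ is contained in the left $\mathcal{H}$-module $\mathrm{k}\langle\mathcal{H}V\rangle$, with $\dim_{\mathrm{k}}(\mathcal{H}V)\leq(\frac{2}{\varepsilon}-1)\dim_{\mathrm{k}}(\mathcal{H})$.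
   Context: Algebras are unital associative, subalgebras contain $1$. $U(\mathcal{A})$ is the group of invertible elements. $\mathrm{k}\langle S\rangle$ is the linear span of a set $S$, $\dim_{\mathrm{k}}(S)=\dim_{\mathrm{k}}\mathrm{k}\langle S\rangle$, and $ST=\{st\mid s\in S,t\in T\}$. Hypothesis $\mathbf{H}_{\mathrm{s}}$: $\mathcal{A}$ is finite-dimensional over $\mathrm{k}$, or $\mathrm{k}\in\{\mathbb{R},\mathbb{C}\}$ and $\mathcal{A}$ is a Banach algebra over $\mathrm{k}$, or $\mathcal{A}$ is a finite product of (possibly infinite-dimensional) field extensions of $\mathrm{k}$. *)

(* Defs.v *)
From mathcomp Require Import all_boot all_algebra.
From mathcomp Require Import complex.
From mathcomp Require Import reals Rstruct.
From Stdlib Require Import Rdefinitions.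

Set Implicit Arguments.
Unset Strict Implicit.
Unset Printing Implicit Defensive.
Import GRing.Theory Num.Theory.
Local Open Scope ring_scope.

Section AlgebraDefs.
Variables (k : fieldType) (A : algType k).

Definition infinite_field : Prop := forall s : seq k, exists x : k, x \notin s.

Definition of_seq (s : seq A) : A -> Prop := fun x => x \in s.

Definition kspan (S : A -> Prop) : A -> Prop :=
  fun x => exists (s : seq A) (c : seq k),
    (forall y, y \in s -> S y) /\ x = \sum_(i < size s) c`_i *: s`_i.

Definition setmul (S T : A -> Prop) : A -> Prop :=
  fun x => exists s t, S s /\ T t /\ x = s * t.

Definition subspace (S : A -> Prop) : Prop :=
  S 0 /\ forall (a : k) x y, S x -> S y -> S (a *: x + y).

Definition free_seq (s : seq A) : Prop :=
  forall c : 'I_(size s) -> k,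
    \sum_(i < size s) c i *: s`_i = 0 -> forall i, c i = 0.

Definition has_dim (S : A -> Prop) (n : nat) : Prop :=
  exists b : seq A, size b = n /\ free_seq b /\
    forall x, S x <-> kspan (of_seq b) x.

Definition subalgebra (S : A -> Prop) : Prop :=
  subspace S /\ S 1 /\ forall x y, S x -> S y -> S (x * y).

Definition invertible (x : A) : Prop := exists y, x * y = 1 /\ y * x = 1.

Definition Hs_findim : Prop := exists s : seq A, forall x, kspan (of_seq s) x.

Definition field_is_R (absk : k -> R) : Prop :=
  exists phi : {rmorphism R -> k}, bijective phi /\ forall r, absk (phi r) = `|r|.

Definition field_is_C (absk : k -> R) : Prop :=
  exists phi : {rmorphism R[i] -> k}, bijective phi /\
    forall z, absk (phi z) = Num.sqrt (complex.Re z ^+ 2 + complex.Im z ^+ 2).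

Definition Hs_banach : Prop :=
  exists absk : k -> R, (field_is_R absk \/ field_is_C absk) /\
  exists N : A -> R,
    (forall x, N x = 0 -> x = 0) /\
    (forall x y, N (x + y) <= N x + N y) /\
    (forall (a : k) x, N (a *: x) = absk a * N x) /\
    (forall x y, N (x * y) <= N x * N y) /\
    (forall u : nat -> A,
       (forall e : R, 0 < e -> exists M : nat, forall p q : nat,
          leq M p -> leq M q -> N (u p - u q) < e) ->
       exists l : A, forall e : R, 0 < e -> exists M : nat, forall p : nat,
          leq M p -> N (u p - l) < e).

(* A is a finite product of (possibly infinite-dimensional) field extensions of k:
   a k-algebra isomorphism A ~= prod_{i<n} K_i, with each K_i a field and a k-algebra *)
Definition Hs_prodfields : Prop :=
  exists (n : nat) (K : 'I_n -> comUnitAlgType k) (f : forall i, A -> K i),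
    (forall i (x : K i), x != 0 -> x \is a GRing.unit) /\
    (forall i (a : k) x y, f i (a *: x + y) = a *: f i x + f i y) /\
    (forall i x y, f i (x * y) = f i x * f i y) /\
    (forall i, f i 1 = 1) /\
    (forall x, (forall i, f i x = 0) -> x = 0) /\
    (forall y : forall i, K i, exists x, forall i, f i x = y i).

Definition Hs : Prop := Hs_findim \/ Hs_banach \/ Hs_prodfields.

End AlgebraDefs.

(* Main.v *)
(* Hamidoune's isoperimetric method. For lam = 1 - eps/2, the cost
   dim (XV) - lam dim X, over the finite-dimensional X meeting the units, is
   submodular and invariant under left translation by units; as
   dim (XV) >= dim X, it attains its minimum. Let H contain 1 and be of least
   dimension among the minimizers. For a unit h in H, both H and h^-1 H
   contain 1, so by submodularity their intersection is again a minimizer and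
   H = h^-1 H. Under H_s every x is a unit up to a scalar translation, so the
   units of H span it and H is a subalgebra. The dimension bounds come from
   comparing the cost of H with that of W. *)
From Stdlib Require Import Rdefinitions.
Require Import Defs.
From mathcomp Require Import all_boot all_order all_algebra.
From mathcomp Require Import complex.
From mathcomp Require Import boolp reals Rstruct lra.
Set Implicit Arguments.
Unset Strict Implicit.
Unset Printing Implicit Defensive.
Import Order.TTheory GRing.Theory Num.Theory.
Local Open Scope ring_scope.

(** * Subspaces and spans in an algebra *)

Section Dimension.
Variables (k : fieldType) (A : algType k).
Implicit Types (S T X Y : A -> Prop) (s t b : seq A) (x y : A).

Lemma subspaceD S x y : subspace S -> S x -> S y -> S (x + y).
Proof. by move=> [_ HS] Sx Sy; rewrite -[x]scale1r; apply: HS. Qed.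

Lemma subspaceZ S (a : k) x : subspace S -> S x -> S (a *: x).
Proof. by move=> [S0 HS] Sx; rewrite -[a *: x]addr0; apply: HS. Qed.

Lemma subspaceB S x y : subspace S -> S x -> S y -> S (x - y).
Proof.
by move=> HS Sx Sy; apply: subspaceD => //; rewrite -scaleN1r; apply: subspaceZ.
Qed.

Lemma subspace_sum S n (F : 'I_n -> A) :
  subspace S -> (forall i, S (F i)) -> S (\sum_i F i).
Proof.
by move=> HS HF; apply: big_ind => //; [case: HS | move=> x y; apply: subspaceD].
Qed.

Lemma subspace_comb S s (c : nat -> k) : subspace S ->
  (forall y, y \in s -> S y) -> S (\sum_(i < size s) c i *: s`_i).
Proof.
move=> HS Hs; apply: subspace_sum => // i.
by apply: subspaceZ => //; exact/Hs/mem_nth.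
Qed.

Lemma kspan_min S T x : subspace T -> (forall y, S y -> T y) ->
  kspan S x -> T x.
Proof.
move=> HT HST [s [c [Hs ->]]].
by apply: (@subspace_comb T s (fun i => c`_i)) => // y /Hs /HST.
Qed.

Lemma kspan_in S x : S x -> kspan S x.
Proof.
move=> Sx; exists [:: x], [:: 1]; split; first by move=> y; rewrite inE => /eqP->.
by rewrite big_ord_recl big_ord0 /= scale1r addr0.
Qed.

Lemma kspan_subspace S : subspace (kspan S).
Proof.
split; first by exists [::], [::]; split => //; rewrite big_ord0.
move=> a x y [s [c [Hs ->]]] [t [d [Ht ->]]].
exists (s ++ t), (mkseq (fun i => a * c`_i) (size s) ++ d); split.
  by move=> z; rewrite mem_cat => /orP[/Hs|/Ht].
rewrite size_cat big_split_ord /= scaler_sumr; congr (_ + _).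
  apply: eq_bigr => i _; rewrite !nth_cat size_mkseq ltn_ord nth_mkseq //.
  by rewrite scalerA.
apply: eq_bigr => i _.
by rewrite !nth_cat size_mkseq ltnNge leq_addr /= addKn.
Qed.

Lemma kspan_mono S T x : (forall y, S y -> T y) -> kspan S x -> kspan T x.
Proof.
move=> HST; apply: kspan_min; first exact: kspan_subspace.
by move=> y /HST; apply: kspan_in.
Qed.

Lemma kspan_lin (f : {linear A -> A}) S T x : (forall y, S y -> T (f y)) ->
  kspan S x -> kspan T (f x).
Proof.
move=> HST; apply: (@kspan_min S (fun x => kspan T (f x))) => [|y /HST].
  have [T0 TD] := kspan_subspace T; split; first by rewrite linear0.
  by move=> a y z Ty Tz; rewrite linearP; apply: TD.
exact: kspan_in.
Qed.

(** Coefficients become functions on [nat], which can be added, shifted and glued without tracking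
    the length of a list. The combinations of [s] form a subspace containing [s], hence its span. *)
Lemma kspan_seqP s x : kspan (of_seq s) x <->
  exists c : nat -> k, x = \sum_(i < size s) c i *: s`_i.
Proof.
split=> [|[c ->]]; last first.
  by apply: subspace_comb; [exact: kspan_subspace | move=> y ys; apply: kspan_in].
apply: (@kspan_min _ (fun x => exists c : nat -> k,
  x = \sum_(i < size s) c i *: s`_i)) => [|y ys].
  split; first by exists (fun=> 0); rewrite big1 // => i _; rewrite scale0r.
  move=> a _ _ [c ->] [d ->]; exists (fun i => a * c i + d i).
  rewrite scaler_sumr -big_split; apply: eq_bigr => i _ /=.
  by rewrite scalerDl scalerA.
(* Since [s] may have repetitions, the coefficient 1 goes to the first occurrence of [y] only. *)
exists (fun i => (i == index y s)%:R).
have ys' : (index y s < size s)%N by rewrite index_mem.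
rewrite (bigD1 (Ordinal ys')) //= eqxx scale1r nth_index // big1 ?addr0 //.
move=> i; rewrite -val_eqE /= => /negbTE ->; exact: scale0r.
Qed.

(** * Linearly independent families *)

Lemma free_seqP s : free_seq s <-> forall c : nat -> k,
  \sum_(i < size s) c i *: s`_i = 0 -> forall i, (i < size s)%N -> c i = 0.
Proof.
split=> Hs c Hc i => [Hi|]; first exact: (Hs (fun j => c j) Hc (Ordinal Hi)).
(* Extension of [c] by zero beyond the length of [s]. *)
pose c' j := if insub j is Some o then c o else 0 : k.
have cE (o : 'I_(size s)) : c' o = c o by rewrite /c' valK.
rewrite -cE; apply: Hs => //; rewrite -[RHS]Hc.
by apply: eq_bigr => j _; rewrite cE.
Qed.

Lemma free_cat s t : free_seq (s ++ t) <-> [/\ free_seq s, free_seq t &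
  forall x, kspan (of_seq s) x -> kspan (of_seq t) x -> x = 0].
Proof.
have sumE (c : nat -> k) : \sum_(i < size (s ++ t)) c i *: (s ++ t)`_i =
    \sum_(i < size s) c i *: s`_i + \sum_(i < size t) c (size s + i)%N *: t`_i.
  rewrite size_cat big_split_ord /=; congr (_ + _); apply: eq_bigr => i _.
    by rewrite nth_cat ltn_ord.
  by rewrite nth_cat ltnNge leq_addr /= addKn.
pose g (c d : nat -> k) i := if (i < size s)%N then c i else d (i - size s)%N.
have glue (c d : nat -> k) :
    \sum_(i < size (s ++ t)) g c d i *: (s ++ t)`_i =
    \sum_(i < size s) c i *: s`_i + \sum_(i < size t) d i *: t`_i.
  rewrite sumE /g.
  congr (_ + _); apply: eq_bigr => i _; first by rewrite ltn_ord.
  by rewrite ltnNge leq_addr /= addKn.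
split=> [/free_seqP Hf|[/free_seqP Hs /free_seqP Ht Hst]].
  have key (c d : nat -> k) :
      \sum_(i < size s) c i *: s`_i + \sum_(i < size t) d i *: t`_i = 0 ->
      (forall i, (i < size s)%N -> c i = 0) /\
      (forall i, (i < size t)%N -> d i = 0).
    rewrite -glue => Hcd; have := Hf _ Hcd; rewrite /g => H; split=> i Hi.
      by have := H i; rewrite size_cat Hi ltn_addr // => ->.
    have := H (size s + i)%N.
    by rewrite size_cat ltn_add2l Hi ltnNge leq_addr /= addKn => ->.
  split.
  - apply/free_seqP => c Hc; have [|//] := key c (fun=> 0).
    by rewrite Hc add0r big1 // => i _; rewrite scale0r.
  - apply/free_seqP => d Hd; have [|_ //] := key (fun=> 0) d.
    by rewrite Hd addr0 big1 // => i _; rewrite scale0r.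
  - move=> x /kspan_seqP[c xc] /kspan_seqP[d xd].
    (* The two expressions of [x] differ by a relation with coefficients [c] on [s] and [- d] on
       [t]. *)
    have [c0 _] : (forall i, (i < size s)%N -> c i = 0) /\
        (forall i, (i < size t)%N -> - d i = 0).
      apply: (key c (fun i => - d i)); rewrite -xc.
      under eq_bigr do rewrite scaleNr.
      by rewrite sumrN -xd subrr.
    by rewrite xc big1 // => i _; rewrite c0 // scale0r.
apply/free_seqP => c; rewrite sumE => Hc.
set a := (X in X + _ = 0) in Hc; set d := (X in _ + X = 0) in Hc.
have Sa : kspan (of_seq s) a by apply/kspan_seqP; exists c.
have Sd : kspan (of_seq t) d.
  by apply/kspan_seqP; exists (fun i => c (size s + i)%N).
have a0 : a = 0.
  apply: Hst => //; have/eqP := Hc; rewrite addr_eq0 => /eqP ->.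
  by rewrite -scaleN1r; apply: subspaceZ Sd; exact: kspan_subspace.
have d0 : d = 0 by rewrite -Hc a0 add0r.
move=> i; rewrite size_cat => Hi.
have [/Hs->//|le_si] := ltnP i (size s).
have := Ht (fun i => c (size s + i)%N) d0 (i - size s)%N.
by rewrite ltn_subLR // subnKC // => ->.
Qed.

Lemma free_seq1 x : x != 0 -> free_seq [:: x].
Proof.
move=> x0; apply/free_seqP => c; rewrite big_ord_recl big_ord0 /= addr0.
by move/eqP; rewrite scaler_eq0 (negbTE x0) orbF => /eqP c0 [].
Qed.

Lemma free_rcons s x : free_seq s -> ~ kspan (of_seq s) x -> free_seq (s ++ [:: x]).
Proof.
move=> Hs Hx; apply/free_cat; split=> //.
  apply: free_seq1; apply: contra_notN Hx => /eqP ->.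
  by case: (kspan_subspace (of_seq s)).
move=> y sy /kspan_seqP[c]; rewrite big_ord_recl big_ord0 /= addr0 => yE.
have [c0|c0] := eqVneq (c 0%N) 0; first by rewrite yE c0 scale0r.
case: Hx; rewrite -[x](scalerK c0) -yE; apply: subspaceZ => //.
exact: kspan_subspace.
Qed.

(** A row vector killing the matrix of coefficients of [s] over [t] is a relation on [s], hence
    zero. The rank is therefore [size s], and it cannot exceed the number of columns [size t]. *)
Lemma free_size_le s t : free_seq s ->
  (forall x, x \in s -> kspan (of_seq t) x) -> (size s <= size t)%N.
Proof.
move=> Hs Hst.
have /choice[c Hc] (i : 'I_(size s)) : exists c : nat -> k,
    s`_i = \sum_(j < size t) c j *: t`_j.
  by apply/kspan_seqP/Hst/mem_nth.
pose M := \matrix_(i < size s, j < size t) c i j.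
rewrite -(eqnP (_ : row_free M)) ?rank_leq_col // -kermx_eq0.
apply/rowV0P => v /sub_kermxP vM; apply/rowP => i; rewrite mxE.
apply: Hs i; under eq_bigr do rewrite Hc scaler_sumr.
rewrite exchange_big big1 //= => j _.
under eq_bigr do rewrite scalerA.
rewrite -scaler_suml; have /rowP/(_ j) := vM; rewrite !mxE => E.
have -> : \sum_(i < size s) v 0 i * c i j = 0.
  by rewrite -[RHS]E; apply: eq_bigr => l _; rewrite mxE.
exact: scale0r.
Qed.

(** As long as [b] does not span [S], append an element of [S] outside its span. A free family in
    [S] has at most [size t] elements, so [size t - size b] decreases until the process stops. *)
Lemma free_extend S t b : subspace S -> (forall x, S x -> kspan (of_seq t) x) ->
  free_seq b -> (forall x, x \in b -> S x) ->
  exists c, [/\ free_seq (b ++ c), forall x, x \in c -> S x &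
    forall x, S x <-> kspan (of_seq (b ++ c)) x].
Proof.
move=> HS St; have [n] := ubnP (size t - size b)%N.
elim: n b => // n IHn b le_n Hb Sb.
have [bS|/existsNP[x /not_implyP[Sx bx]]] :=
  pselect (forall x, S x -> kspan (of_seq b) x).
  exists [::]; rewrite cats0; split=> // x; split; first exact: bS.
  exact: kspan_min.
have Hbx := free_rcons Hb bx.
have Sbx y : y \in b ++ [:: x] -> S y.
  by rewrite mem_cat inE => /orP[/Sb|/eqP->].
have := free_size_le Hbx (fun y Hy => St y (Sbx y Hy)).
rewrite size_cat addn1 => lt_bt.
have [|c [Hc Sc cS]] := IHn (b ++ [:: x]) _ Hbx Sbx.
  rewrite size_cat addn1.
  by rewrite subnS prednK ?subn_gt0.
exists (x :: c); rewrite -[x :: c]/([:: x] ++ c) catA; split=> // y.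
by rewrite inE => /orP[/eqP->|/Sc].
Qed.

Lemma has_dim_ex S t : subspace S -> (forall x, S x -> kspan (of_seq t) x) ->
  exists n, has_dim S n.
Proof.
move=> HS St; have [//|//|c [Hc _ cS]] := @free_extend S t [::] HS St.
  by apply/free_seqP.
by exists (size c), c.
Qed.

(** * Comparison and transport of dimensions *)

Lemma has_dim_ext S T n : (forall x, S x <-> T x) -> has_dim S n -> has_dim T n.
Proof.
by move=> ST [b [sb [fb Sb]]]; exists b; split; [|split] => // x; rewrite -ST.
Qed.

Lemma has_dim_sub S T n : subspace S -> has_dim T n -> (forall x, S x -> T x) ->
  exists p, has_dim S p.
Proof.
by move=> HS [b [_ [_ Tb]]] ST; apply: (@has_dim_ex S b) => // x /ST /Tb.
Qed.

Lemma kspan_map (f : {linear A -> A}) s x :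
  kspan (of_seq s) x -> kspan (of_seq (map f s)) (f x).
Proof.
move=> /kspan_seqP[c ->]; apply/kspan_seqP; exists c.
rewrite linear_sum size_map; apply: eq_bigr => i _.
by rewrite linearZ (nth_map 0).
Qed.

Lemma free_map (f : {linear A -> A}) s :
  injective f -> free_seq s -> free_seq (map f s).
Proof.
move=> inj_f /free_seqP Hs; apply/free_seqP => c Hc; rewrite size_map.
apply: Hs; apply: inj_f; rewrite linear0 -[RHS]Hc linear_sum size_map.
by apply: eq_bigr => i _; rewrite linearZ (nth_map 0).
Qed.

Lemma has_dim_inj (f : {linear A -> A}) S T p q : injective f ->
  (forall x, S x -> T (f x)) -> has_dim S p -> has_dim T q -> (p <= q)%N.
Proof.
move=> inj_f ST [b [<- [fb Sb]]] [c [<- [_ Tc]]].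
rewrite -(size_map f b); apply: free_size_le; first exact: free_map.
by move=> _ /mapP[y yb ->]; apply/Tc/ST/Sb/kspan_in.
Qed.

Lemma has_dim_le S T p q :
  (forall x, S x -> T x) -> has_dim S p -> has_dim T q -> (p <= q)%N.
Proof. by move=> ST; apply: (@has_dim_inj idfun) => //; exact: inj_id. Qed.

Lemma has_dim_preim (f g : {linear A -> A}) S p : cancel f g -> cancel g f ->
  has_dim S p -> has_dim (fun x => S (f x)) p.
Proof.
move=> fK gK [b [<- [fb Sb]]]; exists (map g b); rewrite size_map; split=> //.
split; first exact: free_map (can_inj gK) fb.
move=> x; rewrite Sb; split=> [/(kspan_map g)|/(kspan_map f)]; first by rewrite fK.
by rewrite -map_comp (eq_map (g := id)) ?map_id.
Qed.

Lemma has_dim_eq S T p : subspace T ->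
  (forall x, S x -> T x) -> has_dim S p -> has_dim T p -> forall x, T x -> S x.
Proof.
move=> HT ST [b [sb [fb Sb]]] [c [sc [fc Tc]]] x Tx; apply: contrapT => Sx.
(* An [x] in [T] outside [S] would give [p + 1] independent elements in the span of the [p] elements
   of [c]. *)
have := @free_size_le (b ++ [:: x]) c (free_rcons fb _).
rewrite size_cat addn1 sb sc ltnn => H; suff : false by [].
apply: H; first by rewrite -Sb.
move=> y; rewrite mem_cat inE => /orP[yb|/eqP->]; apply/Tc => //.
by apply/ST/Sb/kspan_in.
Qed.

(** * Sums, intersections and products of subspaces *)

Definition addsp X Y : A -> Prop := fun z => exists x y, [/\ X x, Y y & z = x + y].

Definition capsp X Y : A -> Prop := fun z => X z /\ Y z.

Lemma addsp_subspace X Y : subspace X -> subspace Y -> subspace (addsp X Y).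
Proof.
move=> HX HY; split; first by exists 0, 0; rewrite addr0; split; [case: HX|case: HY|].
move=> a _ _ [x [y [Xx Yy ->]]] [x' [y' [Xx' Yy' ->]]].
exists (a *: x + x'), (a *: y + y'); split; [exact: HX.2 | exact: HY.2 |].
by rewrite scalerDr addrACA.
Qed.

Lemma addspl X Y x : subspace Y -> X x -> addsp X Y x.
Proof. by move=> [Y0 _] Xx; exists x, 0; rewrite addr0. Qed.

Lemma addspr X Y y : subspace X -> Y y -> addsp X Y y.
Proof. by move=> [X0 _] Yy; exists 0, y; rewrite add0r. Qed.

Lemma capsp_subspace X Y : subspace X -> subspace Y -> subspace (capsp X Y).
Proof.
move=> HX HY; split; first by split; [case: HX|case: HY].
by move=> a x y [Xx Yx] [Xy Yy]; split; [exact: HX.2 | exact: HY.2].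
Qed.

(** Grassmann's formula: a basis [b] of the intersection extends to bases [b ++ c] of [X] and
    [b ++ d] of [Y], and the three lists together form a basis of the sum. *)
Lemma has_dim_add_cap X Y p q : subspace X -> subspace Y ->
  has_dim X p -> has_dim Y q -> exists i j,
  [/\ has_dim (capsp X Y) i, has_dim (addsp X Y) j & (i + j = p + q)%N].
Proof.
move=> HX HY dX dY; have HI := capsp_subspace HX HY.
have [r [b [sb [fb Ib]]]] := has_dim_sub HI dX (fun x => @proj1 _ _).
have bI x : x \in b -> capsp X Y x by move=> xb; apply/Ib/kspan_in.
have [tX [_ [_ XtX]]] := dX; have [tY [_ [_ YtY]]] := dY.
have [x /XtX //|//|x /bI[]//|c [fbc cX Xbc]] := @free_extend X tX b HX.
have [x /YtY //|//|x /bI[]//|d [fbd dY' Ybd]] := @free_extend Y tY b HY.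
have fr : free_seq ((b ++ c) ++ d).
  have [_ fd bd] := (free_cat b d).1 fbd.
  (* An element of [X] in the span of [d] lies in both subspaces, so in the span of [b], which meets
     that of [d] trivially. *)
  apply/free_cat; split=> // x /Xbc Xx dx; apply: bd => //.
  by apply/Ib; split=> //; apply: kspan_min dx.
(* The basis witnessing [p] may be another one; comparing [X] with itself both ways identifies the
   two sizes. *)
have pE : p = size (b ++ c).
  have dX' : has_dim X (size (b ++ c)) by exists (b ++ c).
  by apply/eqP; rewrite eqn_leq (has_dim_le _ dX dX') ?(has_dim_le _ dX' dX).
have qE : q = size (b ++ d).
  have dY2 : has_dim Y (size (b ++ d)) by exists (b ++ d).
  by apply/eqP; rewrite eqn_leq (has_dim_le _ dY dY2) ?(has_dim_le _ dY2 dY).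
exists r, (size ((b ++ c) ++ d)); split; last first.
- by rewrite pE qE !size_cat -sb addnACA addnA addnA addnA addnAC.
- exists ((b ++ c) ++ d); split=> //; split=> // z; split; last first.
    apply: kspan_min => [|x]; first exact: addsp_subspace.
    rewrite /of_seq mem_cat => /orP[xbc|/dY' Yx]; last exact: addspr.
    by apply: addspl => //; apply/Xbc/kspan_in.
  move=> [x [y [/Xbc Xx /Ybd Yy ->]]]; apply: subspaceD.
  + exact: kspan_subspace.
  + by apply: kspan_mono Xx => u ub; rewrite /of_seq mem_cat [u \in _]ub.
  + apply: kspan_mono Yy => u; rewrite /of_seq !mem_cat => /orP[->//|->].
    by rewrite orbT.
- by exists b.
Qed.

Lemma has_dim_setmul X Y p q : has_dim X p -> has_dim Y q ->
  exists r, has_dim (kspan (setmul X Y)) r.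
Proof.
move=> [b [_ [_ Xb]]] [c [_ [_ Yc]]].
apply: (@has_dim_ex _ [seq x * y | x <- b, y <- c]); first exact: kspan_subspace.
move=> z; apply: kspan_min; first exact: kspan_subspace.
move=> _ [x [y [/Xb/kspan_seqP[f ->] [/Yc/kspan_seqP[g ->] ->]]]].
rewrite mulr_suml; apply: subspace_sum => [|i]; first exact: kspan_subspace.
rewrite mulr_sumr; apply: subspace_sum => [|j]; first exact: kspan_subspace.
rewrite -scalerAl -scalerAr; do 2!(apply: subspaceZ; first exact: kspan_subspace).
by apply: kspan_in; apply: allpairs_f; apply: mem_nth.
Qed.

Lemma kspan_setmul_mono X Y T z : (forall x, X x -> Y x) ->
  kspan (setmul X T) z -> kspan (setmul Y T) z.
Proof.
move=> XY; apply: kspan_mono => _ [x [t [Xx [Tt ->]]]].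
by exists x, t; split=> //; apply: XY.
Qed.

End Dimension.

(** * Invertibility after a scalar shift *)

Section InvertibleShift.
Variables (k : fieldType) (A : algType k).
Hypothesis k_inf : infinite_field k.
Implicit Type x : A.

Lemma invertibleZ (c : k) x : c != 0 -> invertible x -> invertible (c *: x).
Proof.
move=> c0 [y [xy yx]]; exists (c^-1 *: y).
by rewrite -!scalerAl -!scalerAr !scalerA mulfV // mulVf // !scale1r.
Qed.

Lemma exists_nonroot (p : {poly k}) : p != 0 -> exists t, ~~ root p t.
Proof.
move=> p0; suff [s [us ss]] : exists s : seq k, uniq s /\ size s = size p.
  have /allPn[t _ pt] : ~~ all (root p) s; last by exists t.
  by apply/negP => /(max_poly_roots p0)/(_ us); rewrite ss ltnn.
elim: (size p) => [|m [s [us <-]]]; first by exists [::].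
by have [t ts] := k_inf s; exists (t :: s); rewrite /= ts.
Qed.

(** Some nonzero polynomial [p] annihilates [x]. If [p.[t] != 0], then ['X - t] divides [p - p.[t]],
    and evaluating the quotient at [x] gives an inverse of [x - t] up to the scalar [- p.[t]]. *)
Lemma invertible_shift_findim x : Hs_findim A ->
  exists t : k, invertible (x - t%:A).
Proof.
(* One more power than there are generators, which forces a linear relation. *)
move=> [s sA]; pose pw := [seq x ^+ i | i <- iota 0 (size s).+1].
have size_pw : size pw = (size s).+1 by rewrite size_map size_iota.
have [c [c_rel [i [ci Hi]]]] : exists c : nat -> k,
    \sum_(i < (size s).+1) c i *: x ^+ i = 0 /\
    exists i, c i != 0 /\ (i < (size s).+1)%N.
  apply: contrapT => Hc; suff /(@free_size_le _ _ _ s) : free_seq pw.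
    by rewrite size_pw ltnn => H; suff : false by []; apply: H.
  apply/free_seqP => c; rewrite size_pw => c_rel i Hi.
  apply/eqP/negPn/negP => ci; apply: Hc; exists c; split; last by exists i.
  rewrite -[RHS]c_rel; apply: eq_bigr => j _.
  by rewrite (nth_map 0%N) ?size_iota // nth_iota.
pose p := \poly_(i < (size s).+1) c i.
have px : horner_alg x p = 0.
  rewrite -[RHS]c_rel /p poly_def linear_sum; apply: eq_bigr => j _.
  by rewrite linearZ rmorphXn /= horner_algX mulr_algl.
have [|t /negbTE pt] := @exists_nonroot p.
  by apply: contraNneq ci => p0; rewrite -(coef0 k i) -p0 coef_poly Hi.
exists t; have /factor_theorem[q pq] : root (p - (p.[t])%:P) t.
  by rewrite /root hornerD hornerN hornerC subrr.
have qx : horner_alg x q * (x - t%:A) = (- p.[t])%:A.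
  have -> : x - t%:A = horner_alg x ('X - t%:P).
    by rewrite rmorphB /= horner_algX horner_algC.
  by rewrite -rmorphM -pq rmorphB /= px horner_algC sub0r scaleNr.
have xq : (x - t%:A) * horner_alg x q = (- p.[t])%:A.
  rewrite -qx; have -> : x - t%:A = horner_alg x ('X - t%:P).
    by rewrite rmorphB /= horner_algX horner_algC.
  by rewrite -!rmorphM mulrC.
have pt0 : - p.[t] != 0 by rewrite oppr_eq0; move: pt; rewrite /root => ->.
exists ((- p.[t])^-1 *: horner_alg x q).
by rewrite -scalerAl -scalerAr qx xq scalerA mulVf // scale1r.
Qed.

Lemma invertible_shift_prodfields x : Hs_prodfields A ->
  exists t : k, invertible (x - t%:A).
Proof.
move=> [m [K [f [fK [flin [fM [f1 [finj fsurj]]]]]]]].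
have fB i (t : k) y : f i (y - t%:A) = f i y - t%:A.
  by rewrite addrC -scaleNr flin f1 addrC scaleNr.
(* Each coordinate of [x] equals at most one scalar, recorded as [bad i] (0 when there is none). A
   [t] off this finite list makes all coordinates of [x - t] nonzero, and they are inverted one by
   one. *)
have /choice[bad Hbad] (i : 'I_m) : exists b : k,
    forall t, f i x = t%:A -> t = b.
  have [[b fxb]|no] := pselect (exists b : k, f i x = b%:A).
    exists b => t; rewrite fxb => /eqP; rewrite -subr_eq0 -scalerBl scaler_eq0.
    by rewrite oner_eq0 orbF subr_eq0 => /eqP.
  by exists 0 => t fxt; case: no; exists t.
have [t Ht] := k_inf [seq bad i | i <- enum 'I_m].
have unit_fx i : f i (x - t%:A) \is a GRing.unit.
  apply: fK; rewrite fB subr_eq0; apply/eqP => /Hbad tE.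
  by case/negP: Ht; rewrite tE map_f // mem_enum.
have [y fy] := fsurj (fun i => (f i (x - t%:A))^-1).
have cancel1 z : (forall i, f i z = 1) -> z = 1.
  move=> fz; apply/eqP; rewrite -subr_eq0; apply/eqP/finj => i.
  by rewrite -[X in _ - X]scale1r fB fz scale1r subrr.
exists t, y; split; apply: cancel1 => i; rewrite fM fy; first exact: divrr (unit_fx i).
exact: mulVr (unit_fx i).
Qed.

(** Rescaling by reals of known absolute value is enough for the Neumann series, so the real and
    complex cases merge here. *)
Lemma field_absZ (absk : k -> R) : field_is_R absk \/ field_is_C absk ->
  exists f : {rmorphism R -> k}, forall r, absk (f r) = `|r|.
Proof.
case=> [[f [_ Hf]]|[f [_ Hf]]]; first by exists f.
exists (f \o real_complex R)%FUN => r; rewrite /= Hf /= expr0n addr0.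
exact: sqrtr_sqr.
Qed.

(** * The Neumann series in a complete norm *)

Section Neumann.
Variable N : A -> R.
Hypotheses (N0 : N 0 = 0) (N_eq0 : forall x, N x = 0 -> x = 0).
Hypotheses (N_ge0 : forall x, 0 <= N x) (NN : forall x, N (- x) = N x).
Hypothesis ND : forall x y, N (x + y) <= N x + N y.
Hypothesis NM : forall x y, N (x * y) <= N x * N y.
Hypothesis N_complete : forall u : nat -> A,
  (forall e : R, 0 < e -> exists M : nat, forall p q : nat,
     leq M p -> leq M q -> N (u p - u q) < e) ->
  exists l : A, forall e : R, 0 < e -> exists M : nat, forall p : nat,
     leq M p -> N (u p - l) < e.

Lemma expfV2_small (c e : R) : 0 < e -> exists M, forall p, (M <= p)%N ->
  c * 2^-1 ^+ p < e.
Proof.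
move=> e0; exists (Num.bound (c / e)) => p /upper_nthrootP.
by rewrite exprVn !ltr_pdivrMr ?exprn_gt0 // mulrC.
Qed.

(** The partial sums of the geometric series in [y] are Cauchy, and their limit is a two-sided
    inverse of [1 - y]. *)
Lemma invertible_1sub y : N y <= 2^-1 -> invertible (1 - y).
Proof.
move=> Ny; pose s p := \sum_(i < p) y ^+ i.
(* The factor [N 1] is kept because the norm of the unit may exceed 1. *)
have Nexp i : N (y ^+ i) <= N 1 * 2^-1 ^+ i.
  elim: i => [|i IHi]; first by rewrite !expr0 mulr1.
  by rewrite !exprSr mulrA (le_trans (NM _ _)) // ler_pM.
(* The bound telescopes: the term of index [i] costs [N 1 * 2^-1 ^+ i], the difference of
   consecutive values of [2 * N 1 * 2^-1 ^+ i]. *)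
have tail p j : N (s (p + j)%N - s p) <=
    2 * N 1 * 2^-1 ^+ p - 2 * N 1 * 2^-1 ^+ (p + j).
  elim: j => [|j IHj]; first by rewrite addn0 !subrr N0.
  rewrite addnS {1}/s big_ord_recr /= -/(s _) addrAC (le_trans (ND _ _)) //.
  by have := Nexp (p + j)%N; rewrite exprS; lra.
have tail_le M p : (M <= p)%N -> N (s p - s M) <= 2 * N 1 * 2^-1 ^+ M.
  move=> le_Mp; rewrite -(subnKC le_Mp) (le_trans (tail _ _)) // gerBl.
  by rewrite !mulr_ge0 // exprn_ge0 // invr_ge0.
have [|l lim_l] := N_complete (u := s).
  (* Two tails of size [2 * N 1 * 2^-1 ^+ M] add up to four times a quantity below [e / 4]. *)
  move=> e e0; have e4 : 0 < e / 4 by rewrite divr_gt0.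
  have [M HM] := expfV2_small (N 1) e4; exists M => p q.
  move=> /tail_le Hp /tail_le Hq; have := HM M (leqnn M).
  have -> : s p - s q = (s p - s M) + - (s q - s M).
    by rewrite opprB addrA subrK.
  by have := ND (s p - s M) (- (s q - s M)); rewrite NN; lra.
have lim0 z c : 0 <= c -> (forall p, N z <= c * N (s p - l) + N (y ^+ p)) -> z = 0.
  move=> c0 Hz; apply: N_eq0; apply/eqP; rewrite eq_le N_ge0 andbT.
  apply/ler_addgt0Pr => e e0; rewrite add0r.
  (* Dividing by [c + 1] covers the case [c = 0]. *)
  have d0 : 0 < e / 2 / (c + 1) by rewrite !divr_gt0 // ltr_wpDl.
  have [M1 HM1] := lim_l _ d0.
  have e2 : 0 < e / 2 by rewrite divr_gt0.
  have [M2 HM2] := expfV2_small (N 1) e2.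
  have h1 := HM1 (maxn M1 M2) (leq_maxl _ _).
  have h2 := HM2 (maxn M1 M2) (leq_maxr _ _).
  have h3 := Hz (maxn M1 M2); have h4 := Nexp (maxn M1 M2).
  have h5 : c * N (s (maxn M1 M2) - l) <= e / 2.
    rewrite ltr_pdivlMr ?ltr_wpDl // in h1.
    have := N_ge0 (s (maxn M1 M2) - l); lra.
  lra.
have key1 p : (1 - y) * s p = 1 - y ^+ p.
  by rewrite -opprB mulNr -subrX1 opprB.
have key2 p : s p * (1 - y) = 1 - y ^+ p.
  rewrite -key1; apply: commr_sym; apply: commr_sum => i _.
  by apply/commrX/commr_sym/commrB; [exact: commr1|].
exists l; split; apply/eqP; rewrite -subr_eq0; apply/eqP/(lim0 _ (N (1 - y))) => // p.
  have -> : (1 - y) * l - 1 = - ((1 - y) * (s p - l)) + - y ^+ p.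
    by rewrite mulrBr key1 opprB -addrA -opprD subrK.
  by rewrite (le_trans (ND _ _)) // !NN lerD2r NM.
have -> : l * (1 - y) - 1 = - ((s p - l) * (1 - y)) + - y ^+ p.
  by rewrite mulrBl key2 opprB -addrA -opprD subrK.
by rewrite (le_trans (ND _ _)) // !NN lerD2r mulrC NM.
Qed.

End Neumann.

Lemma invertible_shift_banach x : Hs_banach A ->
  exists t : k, invertible (x - t%:A).
Proof.
move=> [absk [/field_absZ[f Hf] [N [N_eq0 [ND [NZ [NM N_complete]]]]]]].
have N0 : N 0 = 0 by rewrite -(scale0r (0 : A)) NZ -(rmorph0 f) Hf normr0 mul0r.
have NN z : N (- z) = N z.
  by rewrite -scaleN1r NZ -(rmorphN1 f) Hf normrN1 mul1r.
have N_ge0 z : 0 <= N z by have := ND z (- z); rewrite subrr N0 NN; lra.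
(* With this [r] the norm of [f r *: x] is at most 1/2, and the added 1 keeps [r] defined when
   [N x = 0]. The shift is then [(f r)^-1]. *)
pose r : R := (2 * (N x + 1))^-1.
have r0 : 0 < r by rewrite invr_gt0 mulr_gt0 // ltr_wpDl.
have fr0 : f r != 0 by rewrite fmorph_eq0 gt_eqF.
have unit1 : invertible (1 - f r *: x).
  apply: (invertible_1sub N0 N_eq0) => //; rewrite NZ Hf gtr0_norm //.
  rewrite ler_pdivrMl ?mulr_gt0 ?ltr_wpDl //.
  by have := N_ge0 x; lra.
exists (f r)^-1; have -> : x - (f r)^-1%:A = (- (f r)^-1) *: (1 - f r *: x).
  by rewrite scalerBr scalerA mulNr mulVf // !scaleNr scale1r opprK addrC.
by apply: invertibleZ unit1; rewrite oppr_eq0 invr_eq0.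
Qed.

Lemma invertible_shift x : Hs A -> exists t : k, invertible (x - t%:A).
Proof.
case=> [|[]]; [exact: invertible_shift_findim | exact: invertible_shift_banach |].
exact: invertible_shift_prodfields.
Qed.

End InvertibleShift.

(** * Fragments: translation and submodularity *)

Section Atoms.
Variables (k : fieldType) (A : algType k) (V : A -> Prop) (n : nat).
Hypotheses (HV : subspace V) (dimV : has_dim V n).
Hypothesis unitV : exists v, V v /\ invertible v.
Implicit Types (X Y : A -> Prop) (p q : nat).

(** The dimensions of [X] and of the span of [XV] are carried as parameters, so that the cost is
    simply [q - lam * p]. *)
Definition fragment X p q := [/\ subspace X, exists u, X u /\ invertible u,
  has_dim X p & has_dim (kspan (setmul X V)) q].

(** Right multiplication by a unit of [V] embeds [X] into the span of [XV]. *)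
Lemma fragment_le X p q : fragment X p q -> (p <= q)%N.
Proof.
have [v [Vv [w [vw wv]]]] := unitV; move=> [_ _ dX dXV].
apply: (@has_dim_inj _ _ (v \o* (@idfun A)) _ _ _ _ _ _ dX dXV) => [|x Xx].
  by apply: (can_inj (g := fun x => x * w)) => x /=; rewrite -mulrA vw mulr1.
by apply: kspan_in; exists x, v.
Qed.

(** The new subspace is [u^-1 X]. Left multiplication by [u^-1] carries the span of [XV] onto that
    of [u^-1 XV], and [u^-1 X] contains 1. *)
Lemma fragment_translate X p q u : fragment X p q -> X u -> invertible u ->
  fragment (fun y => X (u * y)) p q.
Proof.
move=> [HX _ dX dXV] Xu [w [uw wu]].
pose f : {linear A -> A} := u \*o (@idfun A).
pose g : {linear A -> A} := w \*o (@idfun A).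
have fK : cancel f g by move=> x; rewrite /= mulrA wu mul1r.
have gK : cancel g f by move=> x; rewrite /= mulrA uw mul1r.
split.
- split; first by rewrite mulr0; case: HX.
  by move=> a x y Xx Xy; rewrite mulrDr -scalerAr; apply: HX.2.
- by exists 1; rewrite mulr1; split=> //; exists 1; rewrite mulr1.
- exact: has_dim_preim fK gK dX.
- apply: has_dim_ext (has_dim_preim fK gK dXV) => z; split.
  + move=> H; rewrite -[z]fK; apply: kspan_lin H.
    move=> _ [x [t [Xx [Vt ->]]]]; exists (w * x), t.
    by rewrite /= !mulrA uw mul1r.
  + apply: (@kspan_lin _ _ f) => _ [x [t [Xx [Vt ->]]]].
    by exists (u * x), t; rewrite /= mulrA.
Qed.

(** Grassmann's formula is applied to [X], [Y] and to the spans of [XV], [YV]: the intersection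
    times [V] lies in the intersection of these spans, the sum times [V] in their sum. The common
    element 1 makes the intersection meet the units. *)
Lemma fragment_add_cap X Y p q : fragment X p q -> fragment Y p q ->
  X 1 -> Y 1 -> exists p1 q1 p2 q2,
  [/\ fragment (capsp X Y) p1 q1, fragment (addsp X Y) p2 q2,
      (p1 + p2 = p + p)%N & (q1 + q2 <= q + q)%N].
Proof.
move=> [HX _ dX dXV] [HY _ dY dYV] X1 Y1.
have [p1 [p2 [d1 d2 p12]]] := has_dim_add_cap HX HY dX dY.
have [r1 [r2 [e1 e2 r12]]] :=
  has_dim_add_cap (kspan_subspace _) (kspan_subspace _) dXV dYV.
have [q1 dq1] := has_dim_setmul d1 dimV.
have [q2 dq2] := has_dim_setmul d2 dimV.
have inv1 : invertible (1 : A) by exists 1; rewrite mulr1.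
exists p1, q1, p2, q2; split=> //.
- split=> //; first exact: capsp_subspace.
  by exists 1.
- split=> //; first exact: addsp_subspace.
  by exists 1; split=> //; apply: addspl.
- rewrite -r12 leq_add //.
    apply: has_dim_le dq1 e1 => z Hz.
    by split; apply: kspan_setmul_mono Hz => x [].
  apply: has_dim_le dq2 e2 => z; apply: kspan_min.
    by apply: addsp_subspace; exact: kspan_subspace.
  move=> _ [_ [t [[x [y [Xx Yy ->]]] [Vt ->]]]]; exists (x * t), (y * t).
  by rewrite mulrDl; split=> //; apply: kspan_in; [exists x, t|exists y, t].
Qed.

(** * Minimizing the cost *)

Variable lam : R.
Hypotheses (lam_gt0 : 0 < lam) (lam_lt1 : lam < 1).

(** From [p <= q], a cost at most [C] forces [q <= C / (1 - lam)]. Only finitely many pairs of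
    dimensions compete, so a minimum of the real-valued cost exists. *)
Lemma exists_atom X0 p0 q0 : fragment X0 p0 q0 -> exists X p q,
  [/\ fragment X p q, q%:R - lam * p%:R <= q0%:R - lam * p0%:R,
   (forall Y p' q', fragment Y p' q' -> q%:R - lam * p%:R <= q'%:R - lam * p'%:R) &
   (forall Y p' q', fragment Y p' q' -> q'%:R - lam * p'%:R = q%:R - lam * p%:R ->
      (p <= p')%N)].
Proof.
move=> H0; set C := q0%:R - _.
pose B := Num.bound `|C / (1 - lam)|.
have bounded X p q : fragment X p q -> q%:R - lam * p%:R <= C ->
    (p < B.+1)%N && (q < B.+1)%N.
  move=> /fragment_le le_pq le_C.
  suff le_qB : (q < B.+1)%N by rewrite le_qB (leq_ltn_trans le_pq).
  rewrite ltnS; apply: ltnW; rewrite -(ltr_nat R).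
  apply: le_lt_trans (archi_boundP (normr_ge0 _)).
  apply: le_trans (ler_norm _); rewrite ler_pdivlMr ?subr_gt0 //.
  have : (p%:R : R) <= q%:R by rewrite ler_nat.
  by move=> /(ler_wpM2l (ltW lam_gt0)); lra.
pose P (z : 'I_B.+1 * 'I_B.+1) := `[< exists X, fragment X z.1 z.2 >].
pose cost (z : 'I_B.+1 * 'I_B.+1) : R := z.2%:R - lam * z.1%:R.
have /andP[p0B q0B] := bounded _ _ _ H0 (lexx C).
pose z0 : 'I_B.+1 * 'I_B.+1 := (Ordinal p0B, Ordinal q0B).
have Pz0 : P z0 by apply/asboolP; exists X0.
case: (arg_minP cost Pz0) => z /asboolP[X1 H1] min_z.
have cost_min Y p q : fragment Y p q -> cost z <= q%:R - lam * p%:R.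
  move=> HY; have [le_C|/ltW lt_C] := lerP (q%:R - lam * p%:R) C.
    have /andP[pB qB] := bounded _ _ _ HY le_C.
    by apply: (min_z (Ordinal pB, Ordinal qB)); apply/asboolP; exists Y.
  by apply: le_trans lt_C; apply: (min_z z0).
(* Second minimization: the least dimension among fragments of minimal cost. *)
pose Q p := `[< exists X q, fragment X p q /\ q%:R - lam * p%:R = cost z >].
have exQ : exists p, Q p by exists z.1; apply/asboolP; exists X1, z.2.
have [p /asboolP[X [q [HX costX]]] min_p] := ex_minnP exQ.
exists X, p, q; split=> //.
- by rewrite costX; apply: cost_min H0.
- by move=> Y p' q' HY; rewrite costX; apply: cost_min HY.
- by move=> Y p' q' HY E; apply: min_p; apply/asboolP; exists Y, q'; rewrite E.
Qed.

Lemma exists_stable_fragment X0 p0 q0 : fragment X0 p0 q0 -> exists H p q,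
  [/\ fragment H p q, H 1, q%:R - lam * p%:R <= q0%:R - lam * p0%:R &
   forall u y, invertible u -> H u -> H y -> H (u * y)].
Proof.
move=> /exists_atom[X [p [q [HX le0 min_cost min_dim]]]].
have [_ [x [Xx x_unit]] _ _] := HX.
have HH := fragment_translate HX Xx x_unit.
(* Translating the atom by one of its units puts 1 in it without changing [p] and [q]. *)
set H := (fun y => X (x * y)) in HH.
have H1 : H 1 by rewrite /H mulr1.
exists H, p, q; split=> // u y u_unit Hu Hy.
have HHu := fragment_translate HH Hu u_unit.
have Hu1 : H (u * 1) by rewrite mulr1.
have [p1 [q1 [p2 [q2 [F1 F2 Ep Eq]]]]] := fragment_add_cap HH HHu H1 Hu1.
have c1 := min_cost _ _ _ F1; have c2 := min_cost _ _ _ F2.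
(* The costs of the intersection and the sum add up to at most twice the minimum, so both equal
   it. *)
have cost1 : q1%:R - lam * p1%:R = q%:R - lam * p%:R.
  have EpR : p1%:R + p2%:R = p%:R + p%:R :> R by rewrite -!natrD Ep.
  have EqR : q1%:R + q2%:R <= q%:R + q%:R :> R by rewrite -!natrD ler_nat.
  have : lam * p1%:R + lam * p2%:R = lam * p%:R + lam * p%:R.
    by rewrite -!mulrDr EpR.
  by move=> E; apply/eqP; rewrite eq_le; apply/andP; split; lra.
have le_p := min_dim _ _ _ F1 cost1.
have [_ _ dI _] := F1; have [HS _ dH _] := HH.
(* Minimality of [p] leaves no room for a smaller intersection, so [H] is contained in its translate
   [u^-1 H]. *)
have p1E : p1 = p.
  by apply/eqP; rewrite eqn_leq le_p andbT (has_dim_le _ dI dH) // => z [].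
rewrite p1E in dI.
by have [] := has_dim_eq HS (fun z => @proj1 _ _) dI dH Hy.
Qed.

End Atoms.

(** * The stable fragment as a subalgebra, and its dimension bounds *)

Theorem theorem5p4 (k : fieldType) (A : algType k) (V W : A -> Prop)
    (n m : nat) (eps : R) :
  infinite_field k -> Hs A ->
  subspace V -> has_dim V n -> subspace W -> has_dim W m ->
  (exists v, V v /\ invertible v) -> (exists w, W w /\ invertible w) ->
  leq n m -> 0 < eps -> eps < 2 ->
  (exists d : nat, has_dim (kspan (setmul W V)) d /\ d%:R <= (2 - eps) * n%:R) ->
  exists (H : A -> Prop) (h : nat),
    subalgebra H /\ has_dim H h /\ h%:R <= (2 / eps - 1) * n%:R /\
    (forall v, V v -> kspan (setmul H V) v) /\
    (exists d : nat, has_dim (kspan (setmul H V)) d /\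
                     d%:R <= (2 / eps - 1) * h%:R).
Proof.
move=> k_inf HsA HV dV HW dW unitV unitW le_nm eps0 eps2 [d [dWV le_d]].
(* With this [lam] the hypothesis reads [d <= 2 * lam * n], so [W] has cost at most
   [2 * lam * n - lam * m <= lam * n]. *)
pose lam := 1 - eps / 2.
have lam0 : 0 < lam by rewrite /lam; lra.
have lam1 : lam < 1 by rewrite /lam; lra.
have FW : fragment V W m d by split.
have [H [h [D [FH H1 cost_le stab]]]] :=
  exists_stable_fragment dV unitV lam0 lam1 FW.
have le_hD := fragment_le unitV FH.
have [HH _ dH dHV] := FH.
have subV v : V v -> kspan (setmul H V) v.
  by move=> Vv; apply: kspan_in; exists 1, v; rewrite mul1r.
have le_nD := has_dim_le subV dV dHV.
have nmR : n%:R <= m%:R :> R by rewrite ler_nat.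
have hDR : h%:R <= D%:R :> R by rewrite ler_nat.
have nDR : n%:R <= D%:R :> R by rewrite ler_nat.
have lam_nm := ler_wpM2l (ltW lam0) nmR; have lam_nD := ler_wpM2l (ltW lam0) nDR.
have scaled (a b : R) : eps * a <= (2 - eps) * b -> a <= (2 / eps - 1) * b.
  move=> ab; have -> : 2 / eps - 1 = (2 - eps) / eps.
    by rewrite mulrBl divff ?gt_eqF.
  by rewrite mulrAC ler_pdivlMr // mulrC.
rewrite /lam in cost_le lam_nm lam_nD.
exists H, h; split; [|split=> //; split; [|split=> //; exists D; split=> //]].
- split=> //; split=> // x y Hx Hy.
  have [t xt_unit] := invertible_shift k_inf x HsA.
  (* Split [x * y] as [(x - t) * y + t *: y]; the unit [x - t] lies in [H] because 1 does. *)
  rewrite -[x](subrK t%:A) mulrDl mulr_algl.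
  apply: subspaceD => //; last exact: subspaceZ.
  by apply: stab => //; apply: subspaceB => //; apply: subspaceZ.
(* From [D - lam * h <= lam * n]: using [h <= D] gives [(1 - lam) * h <= lam * n] here, and using
   [n <= D] gives [(1 - lam) * D <= lam * h] in the last goal. *)
- by apply: scaled; lra.
- by apply: scaled; lra.
Qed.
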